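(* Let $X\subset\mathbb{E}$ be a closed convex set with nonempty interior, let $f$ be a twice continuously differentiable convex barrier of $X$, and let $p_\mu$ be the barrier-based smoothing approximation of $\Pi_X$ defined by $f$. Let $z^*\in\mathbb{E}$. If $$\lim_{(z,\mu)\to(z^*,0)}\mathrm{D}p_\mu(z)=T^*$$ (limit over $\mu>0$) for some linear operator $T^*$, then the projector $\Pi_X$ is strictly differentiable at $z^*$ and $\mathrm{D}\Pi_X(z^* )=T^*$. Furthermore, if $\|\mathrm{D}p_\mu(z)-T^*\|=O(\|(z-z^*,\mu)\|^{\xi-1})$ as $(z,\mu)\to(z^*,0)$, with $\xi>1$, then $\Pi_X$ satisfies $$\|\Pi_X(z)-\mathrm{D}\Pi_X(z^* )[z-z^*]-\Pi_X(z^* )\|=O(\|z-z^*\|^{\xi})\quad\text{as } z\to z^*.$$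
   Context: $\mathbb{E}$ is a finite-dimensional real inner product space with induced norm $\|\cdot\|$; $\|(z,\mu)\|=\sqrt{\|z\|^2+\mu^2}$; $\Pi_X$ is the Euclidean projection onto $X$. A barrier of $X$ is a function $f:\mathrm{int}(X)\to\mathbb{R}$ such that $f(x_k)\to\infty$ for any sequence $\{x_k\}\subset\mathrm{int}(X)$ converging to a boundary point of $X$. The barrier-based smoothing approximation of $\Pi_X$ defined by $f$ is $p_\mu(z)=p(z,\mu)$, where for $\mu>0$, $p_\mu(z)\in\mathrm{int}(X)$ is the unique solution of $p_\mu(z)+\mu^2\nabla f(p_\mu(z))=z$, and $p_0(z)=\Pi_X(z)$. $\mathrm{D}p_\mu(z)$ is the Fréchet derivative with respect to $z$ (for $\mu>0$). Strict differentiability of $\Pi_X$ at $z^*$ with derivative $T^*$: for every $\varepsilon>0$ there is $\delta>0$ with $\|\Pi_X(z_2)-\Pi_X(z_1)-T^*[z_2-z_1]\|\le\varepsilon\|z_2-z_1\|$ whenever $\|z_i-z^*\|<\delta$, $i=1,2$. *)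

(* Defs.v *)
From HB Require Import structures.
From mathcomp Require Import all_boot all_order all_algebra.
From mathcomp Require Import sesquilinear.
From mathcomp Require Import all_classical all_reals all_analysis.
Set Implicit Arguments.
Unset Strict Implicit.
Unset Printing Implicit Defensive.
Import Order.TTheory GRing.Theory Num.Theory.
Import numFieldNormedType.Exports.
Local Open Scope classical_set_scope.
Local Open Scope ring_scope.

(* A finite-dimensional real inner product space: the norm of the normed module
   structure is the one induced by the inner product. *)
HB.mixin Record NormedModule_isInnerProductSpace (R : realType) E
    of NormedModule R E := {
  inner : {dot E for @idfun R} ;
  inner_norm : forall x : E, `|x| = Num.sqrt (inner x x)
}.

#[short(type="euclideanSpaceType")]
HB.structure Definition EuclideanSpace (R : realType) :=
  {E of NormedModule R E & Vector R E & NormedModule_isInnerProductSpace R E}.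

Section barrier_smoothing.
Context {R : realType} {E : euclideanSpaceType R}.
Implicit Types (X : set E) (f : E -> R) (x z : E).

Definition boundary X : set E := closure X `\` X°.

Definition opnorm (A : E -> E) : R :=
  sup [set `|A v| | v in [set v : E | `|v| <= 1]].

Definition is_projection X z y := X y /\ forall x, X x -> `|z - y| <= `|z - x|.

Definition projection X z : E := get (is_projection X z).

Definition gradient f x : E :=
  get [set g | forall v, inner g v = 'd f x v].

(* The second derivative is the derivative of the gradient, i.e. the bilinear
   form D^2 f(x) is identified with an operator through the inner product;
   its continuity is meant for the operator norm. *)
Definition twice_continuously_differentiable (U : set E) f :=
  forall x, U x ->
    [/\ differentiable f x,
        differentiable (gradient f) x &
        opnorm ('d (gradient f) y \- 'd (gradient f) x) @[y --> x] --> (0 : R)].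

(* Functions on the interior of X are represented by total functions, whose
   values outside of the interior are irrelevant. *)
Definition is_barrier X f :=
  forall (u : nat -> E) (l : E), (forall n, X° (u n)) -> boundary X l ->
    u @ \oo --> l -> (f \o u) @ \oo --> +oo.

(* p mu z stands for p_mu(z); nothing is required for mu < 0. *)
Definition is_smoothing_approximation X f (p : R -> E -> E) :=
  (forall z, p 0 z = projection X z) /\
  (forall z (mu : R), 0 < mu ->
     unique [set y | X° y /\ y + mu ^+ 2 *: gradient f y = z] (p mu z)).

Definition strictly_differentiable_with (F : E -> E) z (T : {linear E -> E}) :=
  forall eps : R, 0 < eps -> exists2 delta : R, 0 < delta &
    forall z1 z2, `|z1 - z| < delta -> `|z2 - z| < delta ->
      `|F z2 - F z1 - T (z2 - z1)| <= eps * `|z2 - z1|.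

Definition pair_norm z (mu : R) : R := Num.sqrt (`|z| ^+ 2 + mu ^+ 2).

End barrier_smoothing.

(* Main.v *)
(* Since f is convex, y |-> y + mu^2 grad f(y) expands distances, so its inverse
   p_mu is nonexpansive, and differentiable with the inverse derivative. The
   mean value inequality along a segment bounds
   |p_mu(z2) - p_mu(z1) - T(z2 - z1)| by |z2 - z1| times the supremum of
   |D p_mu - T| over the segment. Both conclusions follow by letting mu tend to
   0, because p_mu converges pointwise to the projection. For the growth rate,
   it suffices to take mu <= |z - z*| before the limit, so that |(z - z*, mu)|
   is at most 2 |z - z*|. *)
From HB Require Import structures.
Require Import Defs.
From mathcomp Require Import all_boot all_order all_algebra.
From mathcomp Require Import sesquilinear.
From mathcomp Require Import all_classical all_reals all_analysis.
From mathcomp Require Import ring lra.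
Import Order.TTheory GRing.Theory Num.Theory.
Import numFieldNormedType.Exports.
Local Open Scope classical_set_scope.
Local Open Scope ring_scope.

(** * Inner product geometry and finite-dimensional linear maps *)

Section inner_product.
Context {R : realType} {E : euclideanSpaceType R}.
Implicit Types u v w : E.

Lemma innerC u v : inner u v = inner v u.
Proof. by rewrite (hermC inner) expr0 mul1r. Qed.

Lemma innerDl u v w : inner (u + v) w = inner u w + inner v w.
Proof. exact: (linearDl inner). Qed.

Lemma innerZl (a : R) u v : inner (a *: u) v = a * inner u v.
Proof. exact: (linearZl_LR inner). Qed.

Lemma innerNl u v : inner (- u) v = - inner u v.
Proof. exact: (linearNl inner). Qed.

Lemma innerBl u v w : inner (u - v) w = inner u w - inner v w.
Proof. by rewrite innerDl innerNl. Qed.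

Lemma innerDr u v w : inner w (u + v) = inner w u + inner w v.
Proof. by rewrite innerC innerDl !(innerC w). Qed.

Lemma innerZr (a : R) u v : inner v (a *: u) = a * inner v u.
Proof. by rewrite innerC innerZl (innerC v). Qed.

Lemma innerNr u v : inner u (- v) = - inner u v.
Proof. by rewrite innerC innerNl innerC. Qed.

Lemma innerBr u v w : inner w (u - v) = inner w u - inner w v.
Proof. by rewrite innerDr innerNr. Qed.

Lemma inner_ge0 u : 0 <= inner u u.
Proof.
have [->|u0] := eqVneq u 0; first by rewrite -(scale0r (0 : E)) innerZl mul0r.
exact/ltW/(@neq0_dnorm_gt0 _ _ _ (inner : {dot E for idfun})).
Qed.

Lemma innerxx u : inner u u = `|u| ^+ 2.
Proof. by rewrite inner_norm sqr_sqrtr// inner_ge0. Qed.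

Lemma Cauchy_Schwarz u v : inner u v <= `|u| * `|v|.
Proof.
have [->|v0] := eqVneq v 0.
  by rewrite -(scale0r (0 : E)) innerZr scale0r normr0 mulr0 mul0r.
have v_gt0 : 0 < `|v| by rewrite normr_gt0.
(* The square expands to 2|u|^2|v|^2 - 2|u||v|<u, v>, and the factor |u||v| is cancelled at the
   end. *)
have := inner_ge0 (`|v| *: u - `|u| *: v).
rewrite !(innerBl, innerBr, innerZl, innerZr) (innerC v u) !innerxx => h.
have [u0|u0] := eqVneq u 0.
  by rewrite u0 -(scale0r (0 : E)) innerZl scale0r normr0 !mul0r.
have u_gt0 : 0 < `|u| by rewrite normr_gt0.
rewrite -(@ler_pM2l _ (`|u| * `|v|)) ?mulr_gt0//; nra.
Qed.

Lemma normr_inner u v : `|inner u v| <= `|u| * `|v|.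
Proof.
rewrite ler_norml Cauchy_Schwarz andbT lerNl -innerNl.
by rewrite (le_trans (Cauchy_Schwarz _ _))// normrN.
Qed.

(** The map g |-> <g, .> into the dual space is linear and injective, and the dual has the dimension
    of E, so it is onto. *)
Lemma Riesz (phi : {linear E -> R^o}) : exists g, forall v, inner g v = phi v.
Proof.
pose F (g : E) : 'Hom(E, R^o) := linfun (inner g : {linear E -> R^o}).
have FE g v : F g v = inner g v by rewrite lfunE.
have F_lin : linear F.
  move=> a u v; apply/lfunP => w.
  by rewrite add_lfunE scale_lfunE !FE innerDl innerZl.
pose FL := GRing.isLinear.Build _ _ _ _ F F_lin.
pose L : {linear E -> 'Hom(E, R^o)} := HB.pack F FL.
have Finj : lker (linfun L) == 0%VS.
  apply/lker0P => u v; rewrite !lfunE/= => uv; apply/eqP.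
  rewrite -subr_eq0 -normr_eq0 -sqrf_eq0 -innerxx innerBl.
  by rewrite -!FE uv subrr.
have Fim : limg (linfun L) = fullv.
  apply/eqP; rewrite eqEdim subvf limg_dim_eq ?(eqP Finj) ?capv0//.
  by rewrite !dimvf /dim/= muln1.
have /memv_imgP[g _ phig] : linfun phi \in limg (linfun L) by rewrite Fim memvf.
have FgE : F g = linfun phi by rewrite phig lfunE.
by exists g => v; rewrite -FE FgE lfunE.
Qed.

(** Each coordinate form is an inner product with a fixed vector, whose norm serves as the bound.
    Boundedness of linear maps and compactness of closed bounded sets both rest on this. *)
Lemma coord_bounded n (X : n.-tuple E) : exists2 C : 'I_n -> R,
  forall i, 0 <= C i & forall i v, `|coord X i v| <= C i * `|v|.
Proof.
have /boolp.choice[g gE] i : exists g, forall v, inner g v = coord X i v.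
  exact: (Riesz (coord X i)).
by exists (fun i => `|g i|) => // i v; rewrite -gE normr_inner.
Qed.

Lemma linear_bounded (V : normedModType R) (A : {linear E -> V}) :
  exists2 C : R, 0 <= C & forall v, `|A v| <= C * `|v|.
Proof.
have [C C0 CP] := coord_bounded _ (vbasis {:E}).
exists (\sum_i C i * `|A (vbasis {:E})`_i|) => [|v].
  by apply: sumr_ge0 => i _; rewrite mulr_ge0.
rewrite {1}(coord_vbasis (memvf v)) linear_sum mulr_suml.
apply: le_trans (ler_norm_sum _ _ _) _; apply: ler_sum => i _.
by rewrite linearZ normrZ mulrAC ler_wpM2r.
Qed.

Lemma linear_continuous_fd (V : normedModType R) (A : {linear E -> V}) :
  continuous A.
Proof.
have [C C0 CP] := linear_bounded _ A.
apply: bounded_linear_continuous; apply/linear_boundedP.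
exists C; split; first exact: num_real.
by move=> r Cr x; rewrite (le_trans (CP x))// ler_wpM2r// ltW.
Qed.

Lemma le_opnorm (A : {linear E -> E}) v : `|A v| <= opnorm A * `|v|.
Proof.
have [C C0 CP] := linear_bounded _ A.
have [->|v0] := eqVneq v 0; first by rewrite linear0 !normr0 mulr0.
have v_gt0 : 0 < `|v| by rewrite normr_gt0.
rewrite -ler_pdivrMr//.
have -> : `|A v| / `|v| = `|A (`|v|^-1 *: v)|.
  by rewrite linearZ normrZ normfV normr_id mulrC.
(* Boundedness of A makes the [sup] in [opnorm] a genuine supremum instead of a default value. *)
apply: ub_le_sup.
  exists C => _ [w /= w1 <-]; rewrite (le_trans (CP w))//.
  by rewrite -[leRHS]mulr1 ler_wpM2l.
by exists (`|v|^-1 *: v) => //=; rewrite normrZ normfV normr_id mulVf// gt_eqF.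
Qed.

(** The coordinates of points of A lie in a compact box, so A is a closed subset of the continuous
    image of that box. *)
Lemma bounded_closed_compact_fd (A : set E) (M : R) :
  closed A -> (forall x, A x -> `|x| <= M) -> compact A.
Proof.
move=> Acl AM.
have [C C0 CP] := coord_bounded _ (vbasis {:E}).
pose phi (r : 'rV[R]_(\dim {:E})) : E := \sum_i r 0 i *: (vbasis {:E})`_i.
have phi_cont : continuous phi.
  apply: continuous_big => [|i _ r]; first exact: add_continuous.
  apply: (@cvgZr_tmp _ _ _ _ (nbhs_filter r)); exact: coord_continuous.
pose K := [set r : 'rV[R]_(\dim {:E}) |
  forall i, r ord0 i \in `[- (C i * M), C i * M]].
have Kc : compact K.
  apply: (@rV_compact _  _ (fun i => `[- (C i * M), C i * M]%classic)) => i.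
  exact: segment_compact.
apply: (subclosed_compact Acl (continuous_compact _ Kc)) => [|x Ax].
  exact: continuous_subspaceT phi_cont.
exists (\row_i coord (vbasis {:E}) i x) => /=.
  move=> i; rewrite mxE in_itv/= -ler_norml.
  by rewrite (le_trans (CP i x))// ler_wpM2l// AM.
rewrite /phi [RHS](coord_vbasis (memvf x)).
by apply: eq_bigr => i _; rewrite mxE.
Qed.

End inner_product.

(** * Differentials: epsilon forms, inverse maps, mean value inequality *)

Lemma diff_near (R : realType) (V W : normedModType R) (F : V -> W) (x : V)
    (e : R) : 0 < e -> differentiable F x ->
  \forall h \near (0 : V), `|F (h + x) - F x - 'd F x h| <= e * `|h|.
Proof.
move=> e0 /diff_locallyP[_ /eqaddoP/(_ e e0)].
by apply: filterS => h; rewrite [X in `|X|](_ : _ = F (h + x) - F x - 'd F x h)//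
  !fctE opprD addrA.
Qed.

Lemma near_diff (R : realType) (V W : normedModType R) (F : V -> W) (x : V)
    (L : {linear V -> W}) : continuous L ->
  (forall e : R, 0 < e ->
    \forall h \near (0 : V), `|F (h + x) - F x - L h| <= e * `|h|) ->
  differentiable F x /\ 'd F x = L :> (V -> W).
Proof.
move=> Lc FL.
have FLo : F \o shift x = cst (F x) + L +o_ 0 id.
  apply/eqaddoP => e e0; near=> h.
  rewrite [X in `|X|](_ : _ = F (h + x) - F x - L h); last first.
    by rewrite !fctE opprD addrA.
  by near: h; exact: FL.
have dFL := diff_unique Lc FLo.
by split=> //; apply/diff_locallyP; rewrite dFL.
Unshelve. all: by end_near. Qed.

Section differential.
Context {R : realType} {E : euclideanSpaceType R}.

Lemma diff_expanding (G : E -> E) (y : E) : differentiable G y ->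
  (\forall h \near (0 : E), `|h| <= `|G (h + y) - G y|) ->
  forall v, `|v| <= `|'d G y v|.
Proof.
move=> Gd Gexp v.
have scale0 : t *: v @[t --> (0 : R)] --> (0 : E).
  by rewrite -[X in _ --> X](scale0r v); exact: cvgZr_tmp.
apply/ler_addgt0Pr => e e0.
(* With this tolerance the linearization error at t v is at most t e. The added 1 keeps the
   denominator positive when v = 0. *)
have e'0 : 0 < e / (`|v| + 1) by rewrite divr_gt0// ltr_wpDl.
have H : \forall t \near (0 : R), `|t *: v| <= `|G (t *: v + y) - G y| /\
    `|G (t *: v + y) - G y - 'd G y (t *: v)| <= e / (`|v| + 1) * `|t *: v|.
  exact: (scale0 _ (filterI Gexp (diff_near _ _ _ _ _ _ e'0 Gd))).
have /nbhs_norm0P[d /= d0 Hd] := H.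
have [|] := Hd (d / 2).
  by rewrite /= gtr0_norm ?divr_gt0// ltr_pdivrMr// ltr_pMr// ltr1n.
have d20 : 0 < d / 2 by rewrite divr_gt0.
set t := d / 2; rewrite linearZ normrZ gtr0_norm// => h2 h1.
have {}h1 : t * `|v| <= t * (`|'d G y v| + e).
  rewrite (le_trans h2)// mulrDr -lerBlDl.
  rewrite -[X in _ - X * _](gtr0_norm d20) -normrZ (le_trans (lerB_dist _ _))//.
  rewrite (le_trans h1)// mulrCA ler_pM2l// mulrAC -mulrA.
  by rewrite ler_piMr ?(ltW e0)// ler_pdivrMr ?ltr_wpDl// mul1r lerDl.
by rewrite ler_pM2l in h1.
Qed.

(** An expanding differential is injective, hence invertible in finite dimension, with an inverse
    L^-1 of norm at most 1. The linearization error of q is then controlled by that of G, since q is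
    1-Lipschitz about z. *)
Lemma diff_right_inverse (G q : E -> E) (z : E) :
  (\forall w \near z, G (q w) = w) ->
  (forall w, `|q w - q z| <= `|w - z|) ->
  differentiable G (q z) ->
  (forall v, `|v| <= `|'d G (q z) v|) ->
  differentiable q z.
Proof.
move=> Gq q1 Gd dGexp.
pose L := linfun 'd G (q z).
have LE v : L v = 'd G (q z) v by rewrite lfunE.
have L0 : lker L == 0%VS.
  apply/lker0P => u v uv; apply/eqP; rewrite -subr_eq0 -normr_le0.
  by rewrite (le_trans (dGexp _))// -LE linearB/= uv subrr normr0.
have LV v : `|(L^-1)%VF v| <= `|v|.
  by rewrite (le_trans (dGexp _))// -LE lker0_lfunVK.
have qc : q (h + z) - q z @[h --> (0 : E)] --> (0 : E).
  apply/cvgrPdist_le => e e0; near=> h.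
  rewrite sub0r normrN (le_trans (q1 _))// addrK.
  by near: h; exact: (nbhs0_le e0).
apply: (near_diff _ _ _ q z (L^-1)%VF _ _).1.
  exact: linear_continuous_fd.
move=> e e0; have /qc H1 := diff_near _ _ _ _ _ _ e0 Gd.
have H2 : \forall h \near (0 : E), G (q (h + z)) = h + z.
  by have /nbhs0P := Gq; apply: filterS => h; rewrite addrC.
have Gqz : G (q z) = z by exact: nbhs_singleton Gq.
near=> h.
have H1h : `|G (q (h + z) - q z + q z) - G (q z) - 'd G (q z) (q (h + z) - q z)|
    <= e * `|q (h + z) - q z| by near: h; exact: H1.
rewrite subrK Gqz (near H2 h _) // addrK in H1h.
(* The argument of L^-1 on the right is the linearization error of G at q z for the increment q (h +
   z) - q z, bounded in [H1h]. *)
have -> : q (h + z) - q z - (L^-1)%VF h =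
    - (L^-1)%VF (h - L (q (h + z) - q z)).
  by rewrite linearB/= lker0_lfunK// opprB.
rewrite normrN (le_trans (LV _))// LE (le_trans H1h)// ler_pM2l//.
by rewrite (le_trans (q1 _))// addrK.
Unshelve. all: by end_near. Qed.

(* Scalarize with the inner product against the difference vector itself, so
   that the real mean value theorem applies. *)
Lemma mean_value_bound (q : E -> E) (A : {linear E -> E}) (z1 z2 : E) (e : R) :
  (forall t : R, 0 <= t <= 1 -> differentiable q (z1 + t *: (z2 - z1)) /\
    `|'d q (z1 + t *: (z2 - z1)) (z2 - z1) - A (z2 - z1)| <= e) ->
  `|q z2 - q z1 - A (z2 - z1)| <= e.
Proof.
move=> H; set d := z2 - z1; set w := q z2 - q z1 - A d.
pose g : R -> E := cst z1 + *:%R ^~ d.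
(* Subtracting t A d makes the increment of k over [0, 1] equal to w, and makes its derivative the
   quantity bounded by e. *)
pose k : R -> E := q \o g - *:%R ^~ (A d).
pose phi : {linear E -> R^o} := inner w.
have phi_cont : continuous phi by exact: linear_continuous_fd.
have kd (t : R) : 0 <= t <= 1 ->
    is_derive t 1 (phi \o k) (phi ('d q (g t) d - A d)).
  move=> t01; have [+ _] := H t t01 => /differentiableP qd.
  have gd : is_diff t g ( *:%R ^~ d) by apply: is_diff_eq; rewrite add0r.
  have kd : is_diff t k ('d q (g t) \o *:%R ^~ d - *:%R ^~ (A d)).
    by apply: is_diffB; exact: is_diff_comp.
  have phid : is_diff (k t) phi phi.
    by apply: DiffDef; [exact: linear_differentiable|exact: diff_lin].
  have pkd := is_diff_comp kd phid.
  apply: DeriveDef; first exact: diff_derivable.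
  by rewrite deriveE// diff_val/= !fctE/= !scale1r.
have [||c c01] := @MVT R (phi \o k) (fun t => phi ('d q (g t) d - A d)) 0 1 ltr01.
- by move=> t; rewrite in_itv/= => /andP[t0 t1]; apply: kd; rewrite !ltW.
- apply: derivable_within_continuous => t; rewrite in_itv/= => t01.
  by have [] := kd t t01.
rewrite subr0 mulr1 /= -innerBr.
have -> : k 1 - k 0 = w.
  rewrite /k /g !fctE/= !scale1r !scale0r addr0 subr0 /d addrCA subrr addr0.
  by rewrite addrAC.
(* Now |w|^2 = <w, k'(c)> <= |w| e, so |w| can be cancelled. If w = 0, the hypothesis at t = 0 shows
   0 <= e. *)
rewrite innerxx => wE; have [w0|w0] := eqVneq w 0.
  by rewrite w0 normr0 (le_trans _ (H 0 _).2)// lexx ler01.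
have w_gt0 : 0 < `|w| by rewrite normr_gt0.
rewrite -(ler_pM2l w_gt0) -expr2 wE (le_trans (Cauchy_Schwarz _ _))//.
rewrite ler_pM2l//; move: c01; rewrite in_itv/= => /andP[c0 c1].
by apply: (H c _).2; rewrite !ltW.
Qed.
End differential.

(** * Gradients of convex functions and the projection onto a convex set *)

Section smoothing.
Context {R : realType} {E : euclideanSpaceType R}.
Implicit Types (X : set E) (f : E -> R) (x y z : E).

Lemma inner_gradient f x v : inner (gradient f x) v = 'd f x v.
Proof.
have [g gP] := Riesz ('d f x : {linear E -> R^o}).
exact: (@getPex _ [set g | forall v, inner g v = 'd f x v] (ex_intro _ g gP)).
Qed.

Lemma convex_setE X x y (t : R) : convex_set X -> X x -> X y -> 0 <= t <= 1 ->
  X (t *: x + (1 - t) *: y).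
Proof.
move=> Xc Xx Xy /andP[t0 t1].
by have := Xc x y (Itv01 t0 t1) (mem_set Xx) (mem_set Xy); rewrite inE.
Qed.

(** By convexity the difference quotient of f from x towards y with step t is at most f y - f x, and
    it tends to the directional derivative as t decreases to 0. *)
Lemma gradient_inequality (U : set E) f x y : convex_function U f ->
  U x -> U y -> differentiable f x ->
  inner (gradient f x) (y - x) <= f y - f x.
Proof.
move=> fconv Ux Uy fd; rewrite inner_gradient.
apply/ler_addgt0Pr => e e0.
have e'0 : 0 < e / (`|y - x| + 1) by rewrite divr_gt0// ltr_wpDl.
have scale0 : t *: (y - x) @[t --> (0 : R)^'+] --> (0 : E).
  rewrite -[X in _ --> X](scale0r (y - x)); apply: cvgZr_tmp.
  exact: cvg_at_right_filter.
have H := scale0 _ (diff_near _ _ _ _ _ _ e'0 fd).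
near (0 : R)^'+ => t.
have t0 : 0 < t by near: t; exact: nbhs_right_gt.
have t1 : t <= 1 by near: t; exact: nbhs_right_le.
have : `|f (t *: (y - x) + x) - f x - 'd f x (t *: (y - x))|
    <= e / (`|y - x| + 1) * `|t *: (y - x)| by near: t; exact: H.
have := fconv (Itv01 (ltW t0) t1) y x (mem_set Uy) (mem_set Ux).
rewrite !convRE /conv/= => fxy.
have -> : t *: (y - x) + x = t *: y + (1 - t) *: x.
  by rewrite scalerBr scalerBl scale1r addrCA addrC -addrA addrC.
rewrite linearZ normrZ gtr0_norm// ler_distlC => /andP[_ h].
have {}h : t * 'd f x (y - x) <=
    f (t *: y + (1 - t) *: x) - f x + e / (`|y - x| + 1) * (t * `|y - x|).
  exact: h.
have et : e / (`|y - x| + 1) * (t * `|y - x|) <= t * e.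
  rewrite mulrCA ler_pM2l// mulrAC -mulrA.
  by rewrite ler_piMr ?(ltW e0)// ler_pdivrMr ?ltr_wpDl// mul1r lerDl.
rewrite -(ler_pM2l t0) (le_trans h)//.
by rewrite /unstable.onem in fxy; nra.
Unshelve. all: by end_near. Qed.

Lemma gradient_monotone (U : set E) f x y : convex_function U f ->
  U x -> U y -> differentiable f x -> differentiable f y ->
  0 <= inner (gradient f x - gradient f y) (x - y).
Proof.
move=> fconv Ux Uy fx fy.
have := lerD (gradient_inequality _ _ _ _ fconv Ux Uy fx)
             (gradient_inequality _ _ _ _ fconv Uy Ux fy).
by rewrite !(innerBl, innerBr) => h; lra.
Qed.

Lemma interior_dense X x0 x (e : R) : convex_set X -> X° x0 -> X x -> 0 < e ->
  exists2 y, X° y & `|y - x| <= e.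
Proof.
move=> Xc /nbhs_normP[r /= r0 Xr] Xx e0.
near (0 : R)^'+ => t.
have t0 : 0 < t by near: t; exact: nbhs_right_gt.
have t1 : t <= 1 by near: t; exact: nbhs_right_le.
have te : t * `|x0 - x| <= e.
  have d0 : 0 < `|x0 - x| + 1 by rewrite ltr_wpDl.
  have : t <= e / (`|x0 - x| + 1).
    by near: t; apply: nbhs_right_le; rewrite divr_gt0.
  by rewrite ler_pdivlMr//; apply: le_trans; rewrite ler_pM2l// lerDl.
pose y := t *: x0 + (1 - t) *: x.
have yx : y - x = t *: (x0 - x).
  by rewrite /y scalerBl scale1r scalerBr addrCA addrAC subrr add0r.
exists y; last by rewrite yx normrZ gtr0_norm.
apply/nbhs_normP; exists (t * r) => /= [|w /= wy]; first by rewrite mulr_gt0.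
(* The homothety of centre x and ratio t maps the ball of radius r about x0, contained in X, onto
   the ball of radius t r about y. *)
have -> : w = t *: (x0 - t^-1 *: (y - w)) + (1 - t) *: x.
  rewrite scalerBr scalerA divff ?gt_eqF// scale1r addrAC -/y subKr//.
apply: convex_setE => //; last by rewrite (ltW t0).
apply: Xr => /=; rewrite subKr normrZ gtr0_norm ?invr_gt0//.
by rewrite mulrC ltr_pdivrMr// mulrC.
Unshelve. all: by end_near. Qed.

(** The distance to z attains its minimum on the compact part of X that is no farther from z than
    x0. Existence is what gives meaning to the [get] in [projection]. *)
Lemma projectionP X z : closed X -> X !=set0 ->
  is_projection X z (projection X z).
Proof.
move=> Xcl [x0 Xx0].
pose A := X `&` [set x | `|z - x| <= `|z - x0|].
have Ac : compact A.
  apply: (bounded_closed_compact_fd _ (`|z| + `|z - x0|)) => [|x [_ /= xz]].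
    apply: closedI => //.
    apply: (@closed_comp _ _ (fun x => `|z - x|) [set r | r <= `|z - x0|]).
      by move=> x _; apply: cvg_norm; apply: cvgB; [exact: cvg_cst|exact: cvg_id].
    exact: closed_le.
  by rewrite -[x](subKr z) (le_trans (ler_normB _ _))// lerD2l.
have [] := @compact_EVT_min _ R (fun x => `|z - x|) A _ Ac.
- by exists x0; split => /=.
- apply: continuous_subspaceT => x.
  by apply: cvg_norm; apply: cvgB; [exact: cvg_cst|exact: cvg_id].
move=> c; rewrite inE => -[Xc /= cz] cmin.
apply: (@getPex _ (is_projection X z)); exists c; split => // x Xx.
have [zx|/ltW zx] := leP `|z - x| `|z - x0|; last exact: le_trans zx.
by apply: cmin; rewrite inE.
Qed.

(** Moving from y by t (x - y) stays in X and cannot come closer to z. Expanding the squares gives 2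
    <z - y, x - y> <= t |x - y|^2, with t arbitrarily small. *)
Lemma projection_obtuse X x y z : convex_set X -> is_projection X z y -> X x ->
  inner (z - y) (x - y) <= 0.
Proof.
move=> Xc [Xy ymin] Xx; apply/ler_addgt0Pr => e e0; rewrite add0r.
near (0 : R)^'+ => t.
have t0 : 0 < t by near: t; exact: nbhs_right_gt.
have t1 : t <= 1 by near: t; exact: nbhs_right_le.
have te : t * (`|x - y| ^+ 2) <= e.
  have d0 : 0 < `|x - y| ^+ 2 + 1 by rewrite ltr_wpDl// sqr_ge0.
  have : t <= e / (`|x - y| ^+ 2 + 1).
    by near: t; apply: nbhs_right_le; rewrite divr_gt0.
  by rewrite ler_pdivlMr//; apply: le_trans; rewrite ler_pM2l// lerDl.
have := ymin _ (convex_setE _ _ _ t Xc Xx Xy _).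
rewrite (ltW t0) t1 => /(_ isT).
have -> : z - (t *: x + (1 - t) *: y) = (z - y) - t *: (x - y).
  by rewrite scalerBl scale1r scalerBr addrCA opprD addrA.
rewrite -(@ler_pXn2r _ 2)// ?nnegrE// -!innerxx.
move: (z - y) (x - y) te => u v te.
rewrite !(innerBl, innerBr, innerZl, innerZr) (innerC v u) (innerxx v).
by move=> h; rewrite -(ler_pM2l t0); nra.
Unshelve. all: by end_near. Qed.

End smoothing.

(** * The smoothing maps: nonexpansiveness, differentiability, limit *)

Section barrier.
Context {R : realType} {E : euclideanSpaceType R}.
Context (X : set E) (f : E -> R) (p : R -> E -> E).
Context (X_closed : closed X) (X_convex : convex_set X) (X_int : X° !=set0)
  (f_C2 : twice_continuously_differentiable X° f)
  (f_convex : convex_function X° f)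
  (p_smoothing : is_smoothing_approximation X f p).
Implicit Types (x y z w : E) (mu : R).

Local Notation G mu := (fun y : E => y + mu ^+ 2 *: gradient f y).

Lemma smoothing_interior mu z : 0 < mu -> X° (p mu z).
Proof. by case: p_smoothing => _ H /(H z)[[]]. Qed.

Lemma smoothing_eq mu z : 0 < mu -> G mu (p mu z) = z.
Proof. by case: p_smoothing => _ H /(H z)[[]]. Qed.

(** Monotonicity of the gradient gives |x - y|^2 <= <G x - G y, x - y>, and Cauchy-Schwarz
    concludes. *)
Lemma barrier_map_expanding mu x y : X° x -> X° y ->
  `|x - y| <= `|G mu x - G mu y|.
Proof.
move=> Xx Xy.
have [fx _ _] := f_C2 _ Xx; have [fy _ _] := f_C2 _ Xy.
have mono := gradient_monotone _ _ _ _ f_convex Xx Xy fx fy.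
have [->|xy] := eqVneq x y; first by rewrite subrr normr0.
have xy_gt0 : 0 < `|x - y| by rewrite normr_gt0 subr_eq0.
rewrite -(ler_pM2r xy_gt0) -expr2 -innerxx.
apply: le_trans (Cauchy_Schwarz _ _).
have -> : G mu x - G mu y = (x - y) + mu ^+ 2 *: (gradient f x - gradient f y).
  by rewrite opprD addrACA scalerBr.
by rewrite [leRHS]innerDl innerZl lerDl mulr_ge0// sqr_ge0.
Qed.

Lemma smoothing_nonexpansive mu z w : 0 < mu -> `|p mu w - p mu z| <= `|w - z|.
Proof.
move=> mu0; have Xp u := smoothing_interior mu u mu0.
rewrite (le_trans (barrier_map_expanding mu _ _ (Xp w) (Xp z)))//.
by rewrite !smoothing_eq.
Qed.

Lemma smoothing_differentiable mu z : 0 < mu -> differentiable (p mu) z.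
Proof.
move=> mu0; have Xp := smoothing_interior mu z mu0.
have [_ gd _] := f_C2 _ Xp.
have Gd : differentiable (G mu) (p mu z).
  by apply: differentiableD => //; exact: differentiableZ.
apply: (diff_right_inverse (G mu)) => //.
- by apply: nearW => w; exact: smoothing_eq.
- by move=> w; exact: smoothing_nonexpansive.
- apply: diff_expanding => //.
  (* The interior is open, so the expansion estimate holds for all small increments at p_mu(z) and
     passes to the differential. *)
  have /nbhs_interior/nbhs0P := Xp; apply: filterS => h Xh.
  rewrite -{1}(addrK (p mu z) h); apply: barrier_map_expanding => //.
  by rewrite addrC.
Qed.

(* If x is interior and P is the projection of z, the obtuse angle property of P
   and the monotonicity of the gradient give, for y = p_mu(z),
   |P - y|^2 <= mu^2 <grad f(x), x - y> + <z - y, P - x>. *)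
Lemma smoothing_cvg z : p mu z @[mu --> 0^'+] --> projection X z.
Proof.
have X_neq0 : X !=set0 by case: X_int => x0 /interior_subset; exists x0.
have Pz := projectionP _ z X_closed X_neq0.
set P := projection X z in Pz *.
apply/cvgrPdist_le => e e0.
pose K := `|z - P| + 1.
have K0 : 0 < K by rewrite ltr_wpDl.
have K2 : 0 < 3 * K + 2 by lra.
(* The bounds [h1] and [h2] below add up to d (3 K + 2 d), which is at most d (3 K + 2) because d <=
   1, hence at most e^2. *)
pose d := Num.min 1 (e ^+ 2 / (3 * K + 2)).
have d0 : 0 < d by rewrite lt_min ltr01 divr_gt0// exprn_gt0.
have [x0 Xx0] := X_int.
(* P may lie on the boundary, where f has no usable gradient. The nearby interior point x is fixed
   before mu, so that mu^2 |grad f(x)| can be made small. *)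
have [x Xx xP] := interior_dense _ _ _ _ X_convex Xx0 Pz.1 d0.
have [fx _ _] := f_C2 _ Xx.
near=> mu.
have mu0 : 0 < mu by near: mu; exact: nbhs_right_gt.
have mud : mu ^+ 2 * `|gradient f x| <= d.
  have h0 : 0 < `|gradient f x| + 1 by rewrite ltr_wpDl.
  have mu1 : mu <= 1 by near: mu; exact: nbhs_right_le.
  have : mu <= d / (`|gradient f x| + 1).
    by near: mu; apply: nbhs_right_le; rewrite divr_gt0.
  rewrite ler_pdivlMr//; apply: le_trans; apply: ler_pM => //.
  - by rewrite sqr_ge0.
  - by rewrite expr2 ler_piMl// ltW.
  - by rewrite lerDl.
have Xp := smoothing_interior mu z mu0.
set y := p mu z in Xp *.
have d1 : d <= 1 by rewrite ge_min lexx.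
have de : d * (3 * K + 2) <= e ^+ 2.
  by rewrite -ler_pdivlMr// /d ge_min lexx orbT.
have zx : `|z - x| <= K.
  by rewrite (le_trans (ler_distD P _ _))// lerD2l distrC (le_trans xP).
(* The expansion estimate between y and x bounds p_mu(z) independently of mu, since G maps y to
   z. *)
have yx : `|x - y| <= K + d.
  rewrite distrC (le_trans (barrier_map_expanding mu _ _ Xp Xx))//.
  rewrite smoothing_eq// opprD addrA (le_trans (ler_normB _ _))// lerD//.
  by rewrite normrZ ger0_norm// sqr_ge0.
have zy : `|z - y| <= 2 * K + d.
  by rewrite (le_trans (ler_distD x _ _))// mulr2n mulrDl mul1r -addrA lerD.
have [fy _ _] := f_C2 _ Xp.
have mono := gradient_monotone _ _ _ _ f_convex Xx Xp fx fy.
have zyE : z - y = mu ^+ 2 *: gradient f y.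
  by rewrite -{1}(smoothing_eq mu z mu0) addrAC subrr add0r.
(* Here z - y = mu^2 grad f(y), and monotonicity replaces the uncontrolled grad f(y) by the fixed
   grad f(x). *)
have h1 : inner (z - y) (x - y) <= d * (K + d).
  apply: (@le_trans _ _ (mu ^+ 2 * inner (gradient f x) (x - y))).
    rewrite zyE innerZl ler_wpM2l ?sqr_ge0//.
    by rewrite -subr_ge0 -innerBl.
  apply: (@le_trans _ _ (mu ^+ 2 * `|gradient f x| * `|x - y|)).
    by rewrite -mulrA ler_wpM2l ?sqr_ge0// Cauchy_Schwarz.
  by rewrite ler_pM// mulr_ge0// sqr_ge0.
have h2 : inner (z - y) (P - x) <= (2 * K + d) * d.
  rewrite (le_trans (Cauchy_Schwarz _ _))// ler_pM//.
  by rewrite distrC.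
have h3 := projection_obtuse _ _ _ _ X_convex Pz (interior_subset Xp).
rewrite -(@ler_pXn2r _ 2)// ?nnegrE ?(ltW e0)// -innerxx.
have -> : inner (P - y) (P - y) =
    inner (z - y) (x - y) + inner (z - y) (P - x) + inner (z - P) (y - P).
  by rewrite !(innerBl, innerBr) (innerC P y); ring.
by apply: le_trans de; nra.
Unshelve. all: by end_near. Qed.

(** Both conclusions of the theorem come from this estimate, with e a constant for strict
    differentiability and a power of the distance for the growth rate. The bound on the
    differentials must be uniform in t, because mu is fixed before the mean value inequality is
    applied. *)
Lemma projection_linear_approx (T : {linear E -> E}) (z1 z2 : E) (e : R) :
  (\forall mu \near (0 : R)^'+, forall t, 0 <= t <= 1 ->
    opnorm ('d (p mu) (z1 + t *: (z2 - z1)) \- T) <= e) ->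
  `|projection X z2 - projection X z1 - T (z2 - z1)| <= e * `|z2 - z1|.
Proof.
move=> He.
have pcvg := smoothing_cvg.
have : `|p mu z2 - p mu z1 - T (z2 - z1)| @[mu --> 0^'+] -->
    `|projection X z2 - projection X z1 - T (z2 - z1)|.
  by apply: cvg_norm; apply: cvgB; [exact: cvgB|exact: cvg_cst].
move=> /cvgr_to_le; apply; near=> mu.
have mu0 : 0 < mu by near: mu; exact: nbhs_right_gt.
have Hmu : forall t, 0 <= t <= 1 ->
  opnorm ('d (p mu) (z1 + t *: (z2 - z1)) \- T) <= e by near: mu; exact: He.
apply: mean_value_bound => t /Hmu ht; split.
  exact: smoothing_differentiable.
apply: le_trans (le_opnorm ('d (p mu) (z1 + t *: (z2 - z1)) \- T) _) _.
by rewrite ler_wpM2r.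
Unshelve. all: by end_near. Qed.

End barrier.

(** * Strict differentiability and growth rate of the projection *)

Lemma near_within_pos (R : realType) (V : normedModType R) (x : V)
    (P : V * R -> Prop) :
  (\forall w \near within [set w : V * R | 0 < w.2] (nbhs (x, 0)), P w) ->
  exists2 d : R, 0 < d & forall z (mu : R),
    `|z - x| < d -> 0 < mu < d -> P (z, mu).
Proof.
move=> /nbhs_ballP[d /= d0 dP]; exists d => // z mu zx /andP[mu0 mud].
apply: dP => //; split => /=; first by rewrite -ball_normE/= distrC.
by rewrite -ball_normE/= sub0r normrN gtr0_norm.
Qed.

Lemma strictly_differentiable_diff (R : realType) (E : euclideanSpaceType R)
    (F : E -> E) (z : E) (T : {linear E -> E}) :
  strictly_differentiable_with F z T -> 'd F z = T :> (E -> E).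
Proof.
move=> FT; apply: (near_diff _ _ _ F z T (linear_continuous_fd _ T) _).2.
(* Fixing the first of the two points at z turns strict differentiability into ordinary
   differentiability. *)
move=> e /FT[d d0 Fd]; apply/nbhs_norm0P; exists d => // h /= hd.
by have := Fd z (h + z); rewrite addrK subrr normr0; apply.
Qed.

Lemma segment_norm_le (R : realType) (V : normedModType R) (x y z : V)
    (t d : R) : 0 <= t <= 1 -> `|x - z| <= d -> `|y - z| <= d ->
  `|x + t *: (y - x) - z| <= d.
Proof.
move=> /andP[t0 t1] xz yz.
have -> : x + t *: (y - x) - z = (1 - t) *: (x - z) + t *: (y - z).
  rewrite scalerBl scale1r -[RHS]addrA [- _ + _]addrC -scalerBr opprB.
  by rewrite [y - z + _]addrA subrK addrAC.
rewrite (le_trans (ler_normD _ _))// !normrZ ger0_norm ?subr_ge0// ger0_norm//.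
by nra.
Qed.

Theorem theorem2 (R : realType) (E : euclideanSpaceType R)
    (X : set E) (f : E -> R) (p : R -> E -> E) (zs : E) (T : {linear E -> E})
    (X_closed : closed X) (X_convex : convex_set X) (X_int : X° !=set0)
    (f_C2 : twice_continuously_differentiable X° f)
    (f_convex : convex_function X° f)
    (f_barrier : is_barrier X f)
    (p_smoothing : is_smoothing_approximation X f p)
    (Dp_lim : (fun w : E * R => opnorm ('d (p w.2) (w.1) \- T))
                @ within [set w : E * R | 0 < w.2] (nbhs (zs, 0)) --> (0 : R)) :
  [/\ strictly_differentiable_with (projection X) zs T,
      'd (projection X) zs = T :> (E -> E) &
      forall xi : R, 1 < xi ->
        (fun w : E * R => opnorm ('d (p w.2) (w.1) \- T))
          =O_ (within [set w : E * R | 0 < w.2] (nbhs (zs, 0)))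
          (fun w : E * R => pair_norm (w.1 - zs) w.2 `^ (xi - 1)) ->
        (fun z : E =>
           projection X z - 'd (projection X) zs (z - zs) - projection X zs)
          =O_ zs (fun z : E => `|z - zs| `^ xi)].
Proof.
have strict : strictly_differentiable_with (projection X) zs T.
  move=> e e0.
  have /near_within_pos[d d0 Hd] :
      \forall w \near within [set w : E * R | 0 < w.2] (nbhs (zs, 0)), opnorm ('d (p w.2) (w.1) \- T) <= e.
    exact: (cvgr_le _ Dp_lim e e0).
  exists d => // z1 z2 z1d z2d.
  apply: (projection_linear_approx _ f p) => //; near=> mu => t t01.
  apply: (Hd (z1 + t *: (z2 - z1)) mu).
    (* The larger endpoint distance is a common bound for the whole segment that is still strictly
       below d. *)
    apply: (@le_lt_trans _ _ (Num.max `|z1 - zs| `|z2 - zs|)).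
      by apply: segment_norm_le => //; rewrite le_max lexx ?orbT.
    by rewrite gt_max z1d.
  by apply/andP; split; near: mu; [exact: nbhs_right_gt|exact: nbhs_right_lt].
have dT := strictly_differentiable_diff _ _ _ _ _ strict.
split => // xi xi1 /eqO_exP[k k0 /near_within_pos[d d0 Hd]].
(* The power of 2 comes from bounding the pair norm by 2 r, where r = |z - zs|. *)
apply/eqO_exP; exists (k * 2 `^ (xi - 1)); first by rewrite mulr_gt0// powR_gt0.
apply/nbhs_normP; exists d => // z /=; rewrite distrC => zd.
rewrite dT addrAC.
have [->|z_neq] := eqVneq z zs;
  first by rewrite !subrr linear0 subrr normr0 !mulr_ge0 ?powR_ge0// ltW.
set r := `|z - zs|.
have r0 : 0 < r by rewrite normr_gt0 subr_eq0.
(* Splitting off one factor r gives the form e |z - zs| with e = k (2 r)^(xi - 1). The case r = 0 is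
   treated apart, as mu has to be chosen in (0, r]. *)
have -> : k * 2 `^ (xi - 1) * `|r `^ xi| = k * (2 * r) `^ (xi - 1) * r.
  rewrite ger0_norm ?powR_ge0// powRM ?ler0n ?ltW// -!mulrA; congr (_ * (_ * _)).
  by rewrite -{3}(powRr1 (ltW r0)) -powRD ?subrK ?(gt_eqF r0) ?implybT.
apply: (projection_linear_approx _ f p) => //; near=> mu => t t01.
have mu0 : 0 < mu by near: mu; exact: nbhs_right_gt.
have mur : mu <= r by near: mu; exact: nbhs_right_le.
have ur : `|zs + t *: (z - zs) - zs| <= r.
  by apply: segment_norm_le => //; rewrite subrr normr0 ltW.
have mud : 0 < mu < d by rewrite mu0; near: mu; exact: nbhs_right_lt.
apply: le_trans (ler_norm _) _.
apply: le_trans (Hd _ mu (le_lt_trans ur zd) mud) _ => /=.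
rewrite ler_pM2l// ger0_norm ?powR_ge0// ge0_ler_powR ?nnegrE ?sqrtr_ge0//.
- by rewrite subr_ge0 ltW.
- by rewrite mulr_ge0// ltW.
have r2 : 0 <= 2 * r by rewrite mulr_ge0// ltW.
rewrite /pair_norm -[leRHS](ger0_norm r2) -[leRHS]sqrtr_sqr ler_wsqrtr//.
have : `|zs + t *: (z - zs) - zs| ^+ 2 <= r ^+ 2.
  by rewrite lerXn2r ?nnegrE ?(ltW r0).
have : mu ^+ 2 <= r ^+ 2 by rewrite lerXn2r ?nnegrE ?(ltW r0) ?(ltW mu0).
by nra.
Unshelve. all: by end_near. Qed.
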